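(* Suppose that $\mathbb{F}$ is an algebraically closed field of characteristic $0$. Then any simple finite-dimensional transposed Poisson algebra $(\mathcal{P},\circ,\{\cdot,\cdot\})$ over $\mathbb{F}$ whose Lie bracket is not identically zero is trivial, i.e. $x\circ y=0$ for all $x,y\in\mathcal{P}$.
   Context: A transposed Poisson algebra is a vector space $\mathcal{P}$ with an associative commutative multiplication $\circ$ (not necessarily unital) and a Lie bracket $\{\cdot,\cdot\}$ such that $2x\circ\{y,z\}=\{x\circ y,z\}+\{y,x\circ z\}$ for all $x,y,z\in\mathcal{P}$. An ideal is a proper nonzero subspace $\mathcal{I}$ with $\mathcal{I}\circ\mathcal{P}\subset\mathcal{I}$ and $\{\mathcal{I},\mathcal{P}\}\subset\mathcal{I}$; $\mathcal{P}$ is simple if it contains no ideals. *)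

(* Defs.v *)
From HB Require Import structures.
From mathcomp Require Import all_boot all_order all_algebra.

Set Implicit Arguments.
Unset Strict Implicit.
Unset Printing Implicit Defensive.

Import GRing.Theory.
Local Open Scope ring_scope.

Section Structure.
Context (F : fieldType) (P : lmodType F).
Implicit Types mul br : {bilinear P -> P -> P}.

Definition is_lie_bracket br : Prop :=
  (forall x, br x x = 0) /\
  (forall x y z, br x (br y z) + br y (br z x) + br z (br x y) = 0).

Record is_transposed_poisson mul br : Prop := IsTransposedPoisson {
  tp_mulA : associative mul;
  tp_mulC : commutative mul;
  tp_lie : is_lie_bracket br;
  tp_compat : forall x y z,
    2%:R *: mul x (br y z) = br (mul x y) z + br y (mul x z)
}.

End Structure.

Section Ideals.
Context (F : fieldType) (P : vectType F).
Implicit Types mul br : {bilinear P -> P -> P}.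

(* Ideals are by convention proper and nonzero. One-sided absorption suffices,
   mul being commutative and br alternating. *)
Record is_ideal mul br (I : {vspace P}) : Prop := IsIdeal {
  ideal_nonzero : I != 0%VS;
  ideal_proper : I != fullv;
  ideal_mul : forall x y, x \in I -> mul x y \in I;
  ideal_bracket : forall x y, x \in I -> br x y \in I
}.

Definition is_simple mul br : Prop :=
  forall I : {vspace P}, ~ is_ideal mul br I.

End Ideals.

(* Main.v *)
Require Import Defs.
From HB Require Import structures.
From mathcomp Require Import all_boot all_order all_algebra ring.

Set Implicit Arguments.
Unset Strict Implicit.
Unset Printing Implicit Defensive.

Import GRing.Theory.
Local Open Scope ring_scope.

(** Write L_x for the multiplication y |-> x o y. The compatibility axiom says
that each L_x is a 1/2-derivation of the Lie bracket, that is,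
2 L_x [y, z] = [L_x y, z] + [y, L_x z]; moreover the L_x commute. A subspace
stable under both products is an ideal, so it is 0 or everything. The proof
feeds several subspaces to this dichotomy.

- The derived subspace [P, P] is an ideal and it is nonzero, so the Lie algebra
  is perfect. The centre is an ideal, because 0 = [x o y, z] whenever x is
  central; the bracket being nonzero, the centre is 0.
- In a perfect Lie algebra a 1/2-derivation d is self-adjoint for the Killing
  form k ([killing_half_derivation]): from ad (d x) = 2 d ad x - ad x d and
  tr (ad _) = 0 one gets tr (d ad x) = 0, and k (d x, y) - k (x, d y) is a
  multiple of tr (d ad [x, y]). So the radical of k is an ideal.
- If the radical is everything, k vanishes. Cartan's criterion in the form
  [killing0_ad_nilpotent] then makes every ad x nilpotent, and Engel's theorem
  ([ad_nilpotent_center_neq0]) produces a nonzero central element, which is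
  impossible.
- Hence k is nondegenerate. The trilinear form k ([x, y], z) is cyclic, and
  comparing the three 1/2-derivation identities obtained by moving d around
  shows that it does not matter on which argument d acts
  ([half_derivation_centroid]): L_x [y, z] = [L_x y, z]. The eigenspaces of
  L_x are then ideals, so L_x is a scalar. If L_y = b id with b nonzero, then
  b w = y o w = w o y is a multiple of y for every w, all elements are
  proportional and the bracket vanishes, a contradiction; so every L_y is 0.

For Cartan's criterion, let p_a be the projector onto the generalized eigenspace
P_a of ad x for a, and let phi be any function on the eigenvalues that is additive
whenever a, b and a + b are eigenvalues. Since [P_a, P_b] lies in P_(a+b), the
operator sum_a phi(a) p_a is a derivation, and perfectness together with k = 0
gives sum_a phi(a) a dim(P_a) = 0. Enough functions phi exist to force all the
eigenvalues to vanish ([additive_weighted_sum]). *)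

(** * Traces of endomorphisms *)

Section MatrixTrace.
Variable F : fieldType.

(** In a rank factorization A = C B, idempotence means B C = 1, so that
tr A = tr (B C) counts the rank. *)
Lemma mxtrace_idempotent n (A : 'M[F]_n) :
  A *m A = A -> \tr A = (\rank A)%:R.
Proof.
move=> idA; rewrite -[in LHS](mulmx_base A) mxtrace_mulC.
suff ->: row_base A *m col_base A = 1%:M by rewrite mxtrace1.
apply: (row_full_inj (col_base_full A)).
apply: (row_free_inj (row_base_free A)).
by rewrite mulmx1 mulmxA mulmx_base -mulmxA mulmx_base idA.
Qed.

(** Induction on the size: with A = C B a rank factorization, B C has the same
trace, is again nilpotent, and is smaller because a nilpotent matrix is
singular. Nilpotence is asked vector by vector, which is the form available for
endomorphisms. *)
Lemma mxtrace_nilpotent n (A : 'M[F]_n) :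
  (forall v : 'rV_n, exists k, iter k (mulmxr A) v = 0) -> \tr A = 0.
Proof.
have [m] := ubnP n; elim: m n A => // m IHm n A; rewrite ltnS => le_nm nilA.
have [n0|n_gt0] := posnP n.
  rewrite /mxtrace big1 // => i; have := ltn_ord i.
  by rewrite [X in (_ < X)%N]n0.
have ltAn: (\rank A < n)%N.
  rewrite ltn_neqAle rank_leq_row andbT; apply/negP => freeA.
  pose v : 'rV[F]_n := const_mx 1.
  have v_neq0: v != 0.
    apply/eqP => /rowP/(_ (Ordinal n_gt0)); rewrite !mxE => /eqP.
    by rewrite oner_eq0.
  have [k] := nilA v; apply/eqP; elim: k => //= k.
  apply: contra => /eqP/= vA0; apply/eqP; apply: (row_free_inj freeA).
  by rewrite vA0 mul0mx.
rewrite -(mulmx_base A) mxtrace_mulC.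
have := mulmx_base A; move: (row_base A) (col_base A) => B C CB_A.
apply: IHm => [|v]; first exact: leq_trans ltAn le_nm.
have [k nil_k] := nilA (v *m B); exists k.+1.
rewrite [LHS]/= mulmxA.
suff ->: iter k (mulmxr (B *m C)) v *m B = iter k (mulmxr A) (v *m B).
  by rewrite nil_k mul0mx.
by elim: (k) => //= i IHi; rewrite -!mulmxA CB_A mulmxA IHi.
Qed.

End MatrixTrace.

Section EndTrace.
Variables (F : fieldType) (V : vectType F).
Implicit Types f g : 'End(V).

Import VectorInternalTheory.

Definition lftrace f : F := \tr (f2mx f).

Lemma v2r_lfun f v : v2r (f v) = v2r v *m f2mx f.
Proof. by rewrite unlock /= r2vK. Qed.

Lemma f2mxP f (A : 'M_(dim V)) :
  (forall v, v2r (f v) = v2r v *m A) -> f2mx f = A.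
Proof.
move=> fA; apply/row_matrixP => i; rewrite !rowE.
by rewrite -[delta_mx 0 i]r2vK -v2r_lfun fA.
Qed.

Lemma lftrace_linear : scalar lftrace.
Proof.
move=> c f g; rewrite /lftrace -linearP; congr (\tr _); apply: f2mxP => v.
by rewrite add_lfunE scale_lfunE linearP /= !v2r_lfun mulmxDr -scalemxAr.
Qed.

HB.instance Definition _ :=
  GRing.isLinear.Build F 'End(V) F _ lftrace lftrace_linear.

Lemma f2mx_comp f g : f2mx (f \o g)%VF = f2mx g *m f2mx f.
Proof. by apply: f2mxP => v; rewrite comp_lfunE !v2r_lfun mulmxA. Qed.

Lemma lftraceC f g : lftrace (f \o g)%VF = lftrace (g \o f)%VF.
Proof. by rewrite /lftrace !f2mx_comp mxtrace_mulC. Qed.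

Lemma lftrace_idempotent f : (f \o f)%VF = f ->
  lftrace f = (\dim (limg f))%:R.
Proof.
move=> idf; rewrite /lftrace mxtrace_idempotent -?f2mx_comp ?idf //.
have ->: limg f = mx2vs (vs2mx fullv *m f2mx f) by rewrite unlock.
by rewrite /dimv (mx2vsK _) (eqmxMr (f2mx f) (mx2vsK _)) mul1mx.
Qed.

Lemma lftrace_nilpotent f :
  (forall v, exists k, iter k f v = 0) -> lftrace f = 0.
Proof.
move=> nilf; apply: mxtrace_nilpotent => v; have [k nil_k] := nilf (r2v v).
exists k; rewrite -[v]r2vK; transitivity (v2r (iter k f (r2v v))); last first.
  by rewrite nil_k linear0.
by elim: {nil_k} k => //= k ->; rewrite v2r_lfun.
Qed.

End EndTrace.

(** * Generalized eigenvectors and spectral projectors *)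

Section GeneralizedEigenvectors.
Variables (F : fieldType) (V : vectType F).
Implicit Types (f g : 'End(V)) (a b : F) (u v : V).

(** The exponent is left free instead of being fixed to the dimension, so that
stability under brackets and commuting maps needs no bookkeeping. *)
Definition gen_eigenvector f a v :=
  exists k, iter k (f - a *: \1)%VF v = 0.

Lemma iter_lfun_linear f k : linear (iter k f).
Proof. by elim: k => // k IHk c u v; rewrite 3!iterS IHk linearP. Qed.

HB.instance Definition _ f k :=
  GRing.isLinear.Build F V V _ (iter k f) (iter_lfun_linear f k).

Lemma iter_lfun_comm f g k v :
  (forall u, f (g u) = g (f u)) -> iter k f (g v) = g (iter k f v).
Proof. by move=> fgC; elim: k => //= k ->. Qed.

Lemma shift_lfunE f a v : (f - a *: \1)%VF v = f v - a *: v.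
Proof. by rewrite !lfun_simp. Qed.

Lemma shift_lfun_comm f g a v :
  (forall u, f (g u) = g (f u)) ->
  (f - a *: \1)%VF (g v) = g ((f - a *: \1)%VF v).
Proof.
by move=> fgC; rewrite !shift_lfunE fgC linearB /= [g (_ *: _)]linearZ.
Qed.

Lemma iter_lfun_leq f k l v : (k <= l)%N -> iter k f v = 0 -> iter l f v = 0.
Proof. by move=> le_kl fv0; rewrite -(subnK le_kl) iterD fv0 linear0. Qed.

Lemma gen_eigenvectorD f a u v :
  gen_eigenvector f a u -> gen_eigenvector f a v -> gen_eigenvector f a (u + v).
Proof.
move=> [k fu0] [l fv0]; exists (k + l)%N.
by rewrite linearD /= (iter_lfun_leq (leq_addr l k)) // add0r
           (iter_lfun_leq (leq_addl k l)).
Qed.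

Lemma gen_eigenvectorZ f a c v :
  gen_eigenvector f a v -> gen_eigenvector f a (c *: v).
Proof. by move=> [k fv0]; exists k; rewrite linearZ /= fv0 scaler0. Qed.

Lemma gen_eigenvector0 f a : gen_eigenvector f a 0.
Proof. by exists 0%N. Qed.

Lemma gen_eigenvector_comm f g a v :
  (forall u, f (g u) = g (f u)) ->
  gen_eigenvector f a v -> gen_eigenvector f a (g v).
Proof.
move=> fgC [k fv0]; exists k; rewrite iter_lfun_comm ?fv0 ?linear0 // => u.
exact: shift_lfun_comm.
Qed.

(** By induction on the exponent for a, the vector v is a true eigenvector for
a; then f - b acts on v as the nonzero scalar a - b and cannot be nilpotent. *)
Lemma gen_eigenvector_disjoint f a b v : a != b ->
  gen_eigenvector f a v -> gen_eigenvector f b v -> v = 0.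
Proof.
move=> neq_ab [k]; elim: k v => [|k IHk] v //=.
rewrite -iterS iterSr => fv0 fbv.
have: (f - a *: \1)%VF v = 0.
  apply: IHk fv0 _; apply: gen_eigenvector_comm fbv => u.
  exact/esym/shift_lfun_comm.
move/eqP; rewrite shift_lfunE subr_eq0 => /eqP fv.
have [l] := fbv.
have ->: iter l (f - b *: \1)%VF v = (a - b) ^+ l *: v.
  elim: l {fbv fv0} => [|l /= ->]; first by rewrite scale1r.
  by rewrite linearZ /= shift_lfunE fv -scalerBl scalerA exprSr.
by move/eqP; rewrite scaler_eq0 expf_eq0 subr_eq0 (negPf neq_ab) andbF => /eqP.
Qed.

(** A power of f - c killing the c-term reduces the relation to the other
eigenvalues; by induction that power kills w a for a <> c, and w a is then a
generalized eigenvector for both a and c. *)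
Lemma gen_eigenvector_free f (s : seq F) (w : F -> V) :
  uniq s -> (forall a, gen_eigenvector f a (w a)) ->
  \sum_(a <- s) w a = 0 -> {in s, forall a, w a = 0}.
Proof.
elim: s w => // c s IHs w /= /andP[c_notin uniq_s] eig_w; rewrite big_cons.
move=> sum0; have w0: {in s, forall a, w a = 0}.
  have [k wc0] := eig_w c; pose h := iter k (f - c *: \1)%VF.
  have hw0: {in s, forall a, h (w a) = 0}.
    apply: IHs => // [a|].
      have [l wa0] := eig_w a; exists l; rewrite /h.
      elim: (k) => //= i IHi.
      rewrite iter_lfun_comm ?IHi ?linear0 // => u.
      by apply: shift_lfun_comm => u2; apply/esym; apply: shift_lfun_comm.
    have := congr1 h sum0.
    by rewrite /h linearD /= wc0 add0r linear_sum linear0.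
  move=> a a_in; apply: (@gen_eigenvector_disjoint f a c) => //.
    by apply: contraNneq c_notin => <-.
  by exists k; apply: hw0.
move=> a; rewrite inE => /predU1P[->|]; last exact: w0.
by move: sum0; rewrite big_seq big1 ?addr0.
Qed.

End GeneralizedEigenvectors.

Section SpectralProjectors.
Variable F : closedFieldType.

(** The characteristic polynomial splits into pairwise coprime powers of linear
factors, so by Cayley-Hamilton the kernels of these powers at A span the whole
space; u decomposes the identity along them. *)
Lemma mx_spectral_decomposition n (A : 'M[F]_n) :
  exists s : seq F, exists2 u : F -> 'M[F]_n, uniq s /\ 1%:M = \sum_(a <- s) u a
    & forall a (v : 'rV_n), a \in s ->
      exists k, iter k (mulmxr (A - a%:M)) (v *m u a) = 0.
Proof.
case: n A => [|n] A.
  by exists [::], (fun=> 0) => [|//]; split=> //; rewrite big_nil [LHS]flatmx0.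
have [r def_r] := closed_field_poly_normal (char_poly A).
move: def_r; rewrite (monicP (char_poly_monic A)) scale1r.
rewrite -prodr_undup_exp_count.
set s := undup r => def_chi.
have uniq_s: uniq s by apply: undup_uniq.
pose q (i : 'I_(size s)) := ('X - (s`_i)%:P) ^+ count_mem s`_i r.
have chi_q: char_poly A = \prod_i q i.
  by rewrite def_chi (big_nth 0) big_mkord.
have full: (1%:M <= \sum_i kermxpoly A (q i))%MS.
  rewrite -(kermxpoly_prod A (P := predT)) => [|i j _ _ neq_ji].
    by rewrite kermxpoly_min // -chi_q mxminpoly_dvd_char.
  rewrite coprimep_expl // coprimep_expr // coprimep_XsubC root_XsubC.
  by rewrite nth_uniq // -val_eqE eq_sym in neq_ji *.
have [u def1] := sub_sumsmxP full.
pose w i := u i *m kermxpoly A (q i).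
pose e a := \sum_(i : 'I_(size s) | s`_i == a) w i.
exists s, e.
  split=> //; rewrite (big_nth 0) big_mkord def1; apply: eq_bigr => i _.
  rewrite /e (big_pred1 i) // => j.
  by rewrite /= nth_uniq.
move=> a v a_in; have lt_a: (index a s < size s)%N by rewrite index_mem.
pose i := Ordinal lt_a.
have sia : s`_i = a by rewrite nth_index.
exists (count_mem a r); rewrite /e (big_pred1 i) => [|j]; last first.
  by rewrite /= -{1}sia nth_uniq.
have ->: iter (count_mem a r) (mulmxr (A - a%:M)) (v *m w i)
       = v *m w i *m (A - a%:M) ^+ count_mem a r.
  elim: (count_mem a r) => [|k IHk]; first by rewrite expr0 mulmx1.
  by rewrite iterS IHk /= exprSr -mulmxA.
rewrite /w mulmxA -mulmxA.
suff ->: kermxpoly A (q i) *m (A - a%:M) ^+ count_mem a r = 0.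
  by rewrite mulmx0.
have ->: (A - a%:M) ^+ count_mem a r = horner_mx A (q i).
  by rewrite /q sia rmorphXn rmorphB /= horner_mx_X horner_mx_C.
exact: mulmx_ker.
Qed.

Import VectorInternalTheory.

Variable V : vectType F.
Implicit Types f g : 'End(V).

(** The last clause, which also covers scalars that are not eigenvalues, is what
makes the p a projectors; it follows from the independence of generalized
eigenvectors. *)
Lemma spectral_projectors f :
  exists s : seq F, exists p : F -> 'End(V),
  [/\ uniq s, forall v, v = \sum_(a <- s) p a v,
      forall a v, gen_eigenvector f a (p a v) &
      forall a b v, gen_eigenvector f a v -> p b v = if b == a then v else 0].
Proof.
have [s [u [uniq_s def1] nil_u]] := mx_spectral_decomposition (f2mx f).
pose p a : 'End(V) := if a \in s then Hom (u a) else 0.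
have pE a v : a \in s -> p a v = r2v (v2r v *m u a).
  by rewrite /p => ->; apply: v2r_inj; rewrite r2vK v2r_lfun.
have sum_p v : v = \sum_(a <- s) p a v.
  rewrite big_seq (eq_bigr (fun a => r2v (v2r v *m u a))) => [|a /pE //].
  by rewrite -big_seq -linear_sum /= -mulmx_sumr -def1 mulmx1 v2rK.
have eig_p a v : gen_eigenvector f a (p a v).
  have [a_in|a_notin] := boolP (a \in s); last first.
    by exists 0%N; rewrite /= /p (negPf a_notin) lfunE.
  have [k nil_k] := nil_u a (v2r v) a_in; exists k; rewrite pE //.
  apply: v2r_inj; rewrite linear0 -[RHS]nil_k.
  elim: (k) => [|i /= <-]; first by rewrite r2vK.
  rewrite shift_lfunE linearB /= v2r_lfun [v2r (_ *: _)]linearZ.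
  by rewrite mulmxBr mul_mx_scalar.
exists s, p; split=> // a b v eig_v.
pose t := if a \in s then s else a :: s.
have uniq_t: uniq t by rewrite /t; case: ifP => //= ->.
pose w c := p c v - (if c == a then v else 0).
have eig_w c : gen_eigenvector f c (w c).
  rewrite /w; case: eqP => [->|_]; last by rewrite subr0.
  by rewrite -scaleN1r; apply/gen_eigenvectorD/gen_eigenvectorZ.
have sum_w: \sum_(c <- t) w c = 0.
  rewrite sumrB; apply/eqP; rewrite subr_eq0; apply/eqP.
  have a_in_t : a \in t by rewrite /t; case: ifP => //; rewrite mem_head.
  rewrite -big_mkcond -big_filter filter_pred1_uniq // big_seq1.
  rewrite /t; case: ifP => a_in; first by rewrite -sum_p.
  by rewrite big_cons {1}/p a_in lfunE add0r -sum_p.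
have [b_in|b_notin] := boolP (b \in t).
  apply/eqP; rewrite -subr_eq0; apply/eqP.
  exact: (gen_eigenvector_free uniq_t eig_w).
move: b_notin; rewrite /t; case: ifP => a_in b_notin.
  rewrite /p (negPf b_notin) lfunE; case: eqP => // eq_ba.
  by rewrite eq_ba a_in in b_notin.
move: b_notin; rewrite inE negb_or => /andP[/negPf-> /negPf].
by rewrite /p => ->; rewrite lfunE.
Qed.

(** On the image of q, the map f is a plus a nilpotent, and nilpotents have
trace zero. *)
Lemma lftrace_projector_comp f a (q : 'End(V)) :
  (forall v, gen_eigenvector f a (q v)) ->
  (forall v, gen_eigenvector f a v -> q v = v) ->
  lftrace (q \o f)%VF = a * lftrace q.
Proof.
move=> eig_q qE; pose g := (f - a *: \1)%VF.
have ->: (q \o f = a *: q + (q \o g))%VF.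
  apply/lfunP => v; rewrite add_lfunE scale_lfunE !comp_lfunE shift_lfunE.
  by rewrite linearB linearZ /= addrC subrK.
rewrite linearD linearZ /= [X in _ + X]lftrace_nilpotent ?addr0 // => v.
have [k nil_k] := eig_q (g v); exists k.+1.
rewrite iterSr comp_lfunE -[RHS]nil_k.
elim: (k) => //= i ->; rewrite comp_lfunE; apply: qE.
have eig_g u : gen_eigenvector f a u -> gen_eigenvector f a (g u).
  by apply: gen_eigenvector_comm => w; apply/esym/shift_lfun_comm.
by apply: (eig_g); elim: i => [|i IHi] /=; [apply: eig_q | apply: (eig_g)].
Qed.

End SpectralProjectors.

Lemma endomorphism_eigenvector (F : closedFieldType) (V : vectType F)
    (f : 'End(V)) :
  {:V}%VS != 0%VS -> exists a, exists2 v, v != 0 & f v = a *: v.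
Proof.
move=> V_neq0; have [s [p [_ sum_p eig_p _]]] := spectral_projectors f.
pose v := vpick {:V}; have v_neq0 : v != 0 by rewrite vpick0.
have [a pa_neq0] : exists a, p a v != 0.
  have /hasP[a _ pa_neq0] : has (fun a => p a v != 0) s; last by exists a.
  apply: contraNT v_neq0 => /hasPn p0; rewrite (sum_p v) big_seq.
  rewrite big1 // => a a_in; apply/eqP.
  by rewrite -[_ == _]negbK p0.
have nil_pa : exists k, iter k (f - a *: \1)%VF (p a v) == 0.
  by have [k nil_k] := eig_p a v; exists k; rewrite nil_k.
have [] := ex_minnP nil_pa => -[|k] /= nil_k min_k.
  by rewrite nil_k in pa_neq0.
exists a, (iter k (f - a *: \1)%VF (p a v)).
  by apply/negP => /min_k; rewrite ltnn.
by apply/eqP; rewrite -subr_eq0 -shift_lfunE.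
Qed.

(** * Additive functions on a finite set of scalars *)

Section AdditiveFunctions.
Variables (F : fieldType) (charF0 : [pchar F] =i pred0).

Lemma intr_char0_eq0 (z : int) : ((z%:~R : F) == 0) = (z == 0).
Proof.
have natr_eq0 := (pcharf0P F).1 charF0.
by case: z => n; rewrite ?NegzE ?rmorphN ?oppr_eq0 /= [_%:~R == 0]natr_eq0.
Qed.

Import Num.Theory.

(** If phi could take values in the rationals and separate points, applying it
to sum_a phi(a) a m_a = 0 would give sum_a m_a phi(a)^2 = 0, hence phi(a) = 0.
Such phi are the coordinates with respect to a basis b of the Q-span of s. They
are kept integral by a common denominator N: N c = sum_j (C c j) b_j. A family b
that is not independent is shortened with the help of a relation, at the cost
of enlarging N; so by induction on its length it may be assumed independent. *)
Lemma additive_weighted_sum (s : seq F) (m : F -> nat) :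
  (forall phi : F -> F,
     {in s &, forall a b, a + b \in s -> phi (a + b) = phi a + phi b} ->
     \sum_(a <- s) phi a * a * (m a)%:R = 0) ->
  {in s, forall a, m a != 0%N -> a = 0}.
Proof.
move=> sum0 a a_in ma_neq0; apply/eqP/negPn/negP => a_neq0.
suff absurd k (b : 'I_k -> F) (C : F -> 'I_k -> int) (N : int) : N != 0 ->
    {in s, forall c, N%:~R * c = \sum_j (C c j)%:~R * b j} -> False.
  pose C c (j : 'I_(size s)) : int := (index c s == j)%:R.
  apply: (@absurd (size s) (fun i => s`_i) C 1) => //.
  move=> c c_in; have lt_c: (index c s < size s)%N by rewrite index_mem.
  rewrite /C (bigD1 (Ordinal lt_c)) //= eqxx nth_index // big1 ?addr0 // => j.
  by rewrite -val_eqE eq_sym /= => /negPf->; rewrite mul0r.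
elim: k b C N => [|k IHk] b C N N_neq0 defC.
  have /eqP := defC a a_in.
  by rewrite big_ord0 mulf_eq0 intr_char0_eq0 (negPf N_neq0) (negPf a_neq0).
have indep (r : 'I_k.+1 -> int) :
    \sum_j (r j)%:~R * b j = 0 -> forall j, r j = 0.
  move=> rel_r i; apply/eqP/negPn/negP => ri_neq0.
  (* Multiplying by r i and using the relation r eliminates b i. *)
  pose C' c (l : 'I_k) := r i * C c (lift i l) - C c i * r (lift i l).
  apply: (IHk (b \o lift i) C' (r i * N)); first by rewrite mulf_neq0.
  move=> c c_in; rewrite rmorphM /= -mulrA defC // (bigD1_ord i) //=.
  move/eqP: rel_r; rewrite (bigD1_ord i) //= addr_eq0 => /eqP rel_r.
  rewrite mulrDr mulrCA rel_r mulrN mulr_sumr mulr_sumr addrC -sumrB.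
  by apply: eq_bigr => l _; rewrite /C' rmorphB !rmorphM /= mulrBl !mulrA.
have phi_add j :
    {in s &, forall c d, c + d \in s -> C (c + d) j = C c j + C d j}.
  move=> c d c_in d_in cd_in; apply/eqP; rewrite -subr_eq0; apply/eqP.
  apply: (indep (fun j => C (c + d) j - (C c j + C d j))).
  under eq_bigr do rewrite rmorphB rmorphD /= mulrBl mulrDl.
  by rewrite sumrB big_split -!defC //= mulrDr subrr.
suff Ca0 j : C a j = 0.
  have /eqP := defC a a_in; rewrite big1 => [|j _]; last by rewrite Ca0 mul0r.
  by rewrite mulf_eq0 intr_char0_eq0 (negPf N_neq0) (negPf a_neq0).
pose r l := \sum_(c <- s) C c j * C c l * (m c)%:R.
have rj0: r j = 0.
  have/sum0/(congr1 (GRing.mul N%:~R)):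
      {in s &, forall c d, c + d \in s ->
        (C (c + d) j)%:~R = (C c j)%:~R + (C d j)%:~R :> F}.
    by move=> c d c_in d_in cd_in; rewrite -rmorphD phi_add.
  rewrite mulr0 => sumC0; apply: indep; rewrite -[RHS]sumC0 mulr_sumr.
  under eq_bigr do rewrite /r rmorph_sum mulr_suml.
  rewrite exchange_big /= big_seq [RHS]big_seq; apply: eq_bigr => c c_in.
  rewrite -mulrA mulrCA [N%:~R * _]mulrA defC // mulr_suml mulr_sumr.
  apply: eq_bigr => l _.
  by rewrite !rmorphM /= rmorph_nat -!mulrA [b l * _]mulrC.
move/eqP: rj0; rewrite /r psumr_eq0 => [/allP/(_ a a_in)|c _]; last first.
  by rewrite -expr2 mulr_ge0 ?sqr_ge0 ?ler0n.
by rewrite /= !mulf_eq0 pnatr_eq0 (negPf ma_neq0) orbF orbb => /eqP.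
Qed.

End AdditiveFunctions.

(** * Lie brackets and the Killing form *)

Lemma bilinear_left_kernel (F : fieldType) (U V W : vectType F)
    (b : {bilinear U -> V -> W}) :
  exists K : {vspace U}, forall x, x \in K <-> forall y, b x y = 0.
Proof.
pose e := vbasis {:V}.
exists (\bigcap_(i < size e) lker (linfun (applyr b e`_i)))%VS => x.
rewrite memvE; split=> [|b0]; last first.
  apply/subv_bigcapP => i _.
  by rewrite -memvE memv_ker lfunE /= b0.
move/subv_bigcapP => ker_x y.
rewrite (coord_vbasis (memvf y)) linear_sumr big1 // => i _.
have lt_i : (i < size e)%N by rewrite size_tuple.
have := ker_x (Ordinal lt_i) isT.
by rewrite -memvE memv_ker lfunE /= linearZr_LR => /eqP->; rewrite scaler0.
Qed.

Section LieAlgebras.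
Variables (F : fieldType) (V : vectType F) (br : {bilinear V -> V -> V}).
Hypothesis lie_br : is_lie_bracket br.

Lemma brC x y : br y x = - br x y.
Proof.
have [br0 _] := lie_br; apply/eqP; rewrite -addr_eq0.
by have := br0 (x + y); rewrite linearDl !linearDr !br0 add0r addr0 addrC => ->.
Qed.

Lemma br_derivation x y z : br x (br y z) = br (br x y) z + br y (br x z).
Proof.
have [_ jacobi] := lie_br; have := jacobi x y z.
rewrite [br z x]brC linearNr [br z _]brC.
by move/eqP; rewrite subr_eq0 subr_eq => /eqP->; rewrite addrC.
Qed.

(** Since ad x is a derivation, ad x - (a + b) acts on [y, z] as
[(ad x - a) y, z] + [y, (ad x - b) z], so i + j applications suffice. *)
Lemma gen_eigenvector_br x a b y z :
  gen_eigenvector (linfun (br x)) a y -> gen_eigenvector (linfun (br x)) b z ->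
  gen_eigenvector (linfun (br x)) (a + b) (br y z).
Proof.
move=> [i yi0] [j zj0]; exists (i + j)%N.
have [k] := ubnP (i + j); elim: k => // k IHk in i j y z yi0 zj0 *.
rewrite ltnS => le_ijk.
case: i j yi0 zj0 le_ijk => [|i] [|j].
- by move=> y0 _ _; rewrite (y0 : y = 0) linear0l linear0.
- by move=> y0 _ _; rewrite (y0 : y = 0) linear0l linear0.
- by move=> _ z0 _; rewrite (z0 : z = 0) linear0r linear0.
rewrite addSn => yi0 zj0 lt_ijk; rewrite iterSr.
have ->: (linfun (br x) - (a + b) *: \1)%VF (br y z)
    = br ((linfun (br x) - a *: \1)%VF y) z
      + br y ((linfun (br x) - b *: \1)%VF z).
  rewrite !shift_lfunE !lfunE /= br_derivation linearBl linearBr.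
  by rewrite linearZl_LR linearZr_LR /= scalerDl opprD addrACA.
have yi0' := yi0; rewrite iterSr in yi0'.
have zj0' := zj0; rewrite iterSr in zj0'.
rewrite linearD /= [X in X + _](IHk _ _ _ _ yi0' zj0) // add0r.
by rewrite addnS -addSn (IHk _ _ _ _ yi0 zj0') // addSn -addnS.
Qed.

Definition ad x : 'End(V) := linfun (br x).

Lemma adE x y : ad x y = br x y. Proof. exact: lfunE. Qed.

Lemma ad_linear : linear ad.
Proof.
move=> c x y; apply/lfunP => z.
by rewrite add_lfunE scale_lfunE !adE linearDl linearZl_LR.
Qed.

HB.instance Definition _ := GRing.isLinear.Build F V 'End(V) _ ad ad_linear.

Lemma ad_br x y : ad (br x y) = (ad x \o ad y)%VF - (ad y \o ad x)%VF.
Proof.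
apply/lfunP => z; rewrite add_lfunE opp_lfunE !comp_lfunE !adE.
by rewrite [br x (br y z)]br_derivation addrK.
Qed.

(** The values lie in the regular module F^o because bilinear maps take values
in a module. *)
Definition killing x y : F^o := lftrace (ad x \o ad y)%VF.

Lemma killing_bilinear :
  bilinear_for (GRing.Scale.Law.clone _ _ *:%R _)
    (GRing.Scale.Law.clone _ _ *:%R _) killing.
Proof.
split=> [y c x x'|x c y y']; rewrite /killing linearP.
  by rewrite comp_lfunDl -comp_lfunZl linearP.
by rewrite comp_lfunDr -comp_lfunZr linearP.
Qed.

HB.instance Definition _ :=
  bilinear_isBilinear.Build F V V F^o _ _ killing killing_bilinear.

Lemma killingC x y : killing x y = killing y x.
Proof. exact: lftraceC. Qed.

Lemma killing_invariant x y z : killing (br x y) z = killing x (br y z).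
Proof.
rewrite /killing !ad_br // comp_lfunDl comp_lfunDr comp_lfunNl comp_lfunNr.
rewrite !linearB /= !comp_lfunA; congr (_ - _).
by rewrite -comp_lfunA lftraceC.
Qed.

(** This says [V, V] = V without a choice of generators for [V, V]. *)
Definition perfect :=
  forall W : {vspace V}, (forall x y, br x y \in W) -> W = fullv.

Lemma perfect_linear0 (U : vectType F) (h : {linear V -> U}) : perfect ->
  (forall x y, h (br x y) = 0) -> forall x, h x = 0.
Proof.
move=> perfect_br hbr0 x; have := memvf x.
rewrite -(perfect_br (lker (linfun h))) => [|y z].
  by rewrite memv_ker lfunE => /eqP.
by rewrite memv_ker lfunE /= hbr0.
Qed.

Lemma lftrace_ad0 : perfect -> forall x, lftrace (ad x) = 0.
Proof.
move=> perfect_br x; have tr_br y z : lftrace (ad (br y z)) = 0.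
  by rewrite ad_br linearB /= lftraceC subrr.
pose h : {linear V -> F^o} := @lftrace F V \o ad.
exact: (perfect_linear0 (h := h) perfect_br tr_br x).
Qed.

(** On a bracket, d o ad x = ad (d x) + ad x o d and cyclicity of the trace give
tr (d o ad [x, y]) = k (d x, y) = 0; brackets span everything. *)
Lemma lftrace_derivation_ad (d : 'End(V)) :
    perfect -> (forall x y, killing x y = 0) ->
    (forall x y, d (br x y) = br (d x) y + br x (d y)) ->
  forall x, lftrace (d \o ad x)%VF = 0.
Proof.
move=> perfect_br killing0 derivd x.
pose h y : F^o := lftrace (d \o ad y)%VF.
have lin_h : linear h.
  by move=> c y z; rewrite /h linearP comp_lfunDr -comp_lfunZr linearP.
pose lh := GRing.isLinear.Build F V F^o *:%R h lin_h.
pose H : {linear V -> F^o} := HB.pack h lh.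
apply: (perfect_linear0 (h := H)) => // {}x y; rewrite /= /h.
have d_ad : (d \o ad x = ad (d x) + (ad x \o d))%VF.
  by apply/lfunP => z; rewrite add_lfunE !comp_lfunE !adE derivd.
rewrite ad_br comp_lfunDr comp_lfunNr linearB /= comp_lfunA d_ad.
rewrite comp_lfunDl linearD /=.
have -> : lftrace (ad (d x) \o ad y)%VF = 0 by apply: killing0.
rewrite add0r.
by rewrite -comp_lfunA lftraceC -comp_lfunA subrr.
Qed.

End LieAlgebras.

(** * Cartan's criterion for perfect Lie algebras *)

Section Cartan.
Variables (F : closedFieldType) (charF0 : [pchar F] =i pred0).
Variables (V : vectType F) (br : {bilinear V -> V -> V}).
Hypothesis lie_br : is_lie_bracket br.

(** For phi additive on the eigenvalues of ad x, the operator d acting on the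
generalized eigenspace P_a as phi(a) is a derivation, so tr (d o ad x) = 0. Up
to nilpotents this trace is sum_a phi(a) a dim(P_a). *)
Lemma killing0_ad_nilpotent :
  perfect br -> (forall x y, killing br x y = 0) ->
  forall x v, exists k, iter k (br x) v = 0.
Proof.
move=> perfect_br killing0 x v.
have [s [p [uniq_s sum_p eig_p pE]]] := spectral_projectors (ad br x).
have p_id a u : gen_eigenvector (ad br x) a u -> p a u = u.
  by move=> /pE->; rewrite eqxx.
have eig_notin a u : a \notin s -> gen_eigenvector (ad br x) a u -> u = 0.
  move=> a_notin eig_u; rewrite (sum_p u) big_seq big1 // => b b_in.
  by rewrite (pE a) //; case: eqP a_notin => // <-; rewrite b_in.
have eig0 : {in s, forall a, \dim (limg (p a)) != 0%N -> a = 0}.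
  apply: additive_weighted_sum => // phi phi_add.
  pose d := \sum_(a <- s) phi a *: p a.
  have dE a u : a \in s -> gen_eigenvector (ad br x) a u -> d u = phi a *: u.
    move=> a_in eig_u; rewrite sum_lfunE (bigD1_seq a) //= big1 => [|b neq_ba].
      by rewrite addr0 scale_lfunE p_id.
    by rewrite scale_lfunE (pE a) // (negPf neq_ba) scaler0.
  have d_br_eig a b y z : a \in s -> b \in s ->
      gen_eigenvector (ad br x) a y -> gen_eigenvector (ad br x) b z ->
      d (br y z) = br (d y) z + br y (d z).
    move=> a_in b_in eig_y eig_z.
    rewrite (dE a y) // (dE b z) // linearZl_LR linearZr_LR /= -scalerDl.
    have eig_yz := gen_eigenvector_br lie_br eig_y eig_z.
    have [ab_in|ab_notin] := boolP (a + b \in s).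
      by rewrite (dE (a + b)) // phi_add.
    by rewrite (eig_notin _ _ ab_notin eig_yz) linear0 scaler0.
  have d_br y z : d (br y z) = br (d y) z + br y (d z).
    rewrite (sum_p y) big_seq.
    apply: (big_ind (fun y => d (br y z) = br (d y) z + br y (d z))).
    - by rewrite linear0 !linear0l linear0 addr0.
    - move=> y1 y2 IH1 IH2; rewrite [d (y1 + y2)]linearD !linearDl linearD /=.
      by rewrite IH1 IH2 addrACA.
    move=> a a_in; rewrite (sum_p z) big_seq.
    pose w := p a y; rewrite -/w.
    apply: (big_ind (fun z => d (br w z) = br (d w) z + br w (d z))).
    - by rewrite [d 0]linear0 !linear0r linear0 addr0.
    - move=> z1 z2 IH1 IH2; rewrite [d (z1 + z2)]linearD !linearDr linearD /=.
      by rewrite IH1 IH2 addrACA.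
    by move=> b b_in; apply: (d_br_eig a b) => //; apply: eig_p.
  have := lftrace_derivation_ad lie_br perfect_br killing0 d_br x.
  rewrite -[in LHS]/d => tr0; rewrite -[RHS]tr0.
  have ->: (d \o ad br x = \sum_(a <- s) phi a *: (p a \o ad br x))%VF.
    apply/lfunP => u; rewrite comp_lfunE !sum_lfunE.
    by apply: eq_bigr => a _; rewrite !scale_lfunE comp_lfunE.
  rewrite linear_sum; apply: eq_bigr => a _.
  rewrite linearZ /= (lftrace_projector_comp (eig_p a) (p_id a)) mulrA.
  rewrite lftrace_idempotent //.
  by apply/lfunP => u; rewrite comp_lfunE p_id.
suff [k]: gen_eigenvector (ad br x) 0 v.
  rewrite scale0r subr0 (eq_iter (adE br x)) => nil_k.
  by exists k.
rewrite (sum_p v) big_seq; apply: big_ind => [|u w|a a_in].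
- exact: gen_eigenvector0.
- exact: gen_eigenvectorD.
have [/eqP dim0|/(eig0 a a_in) a0] := boolP (\dim (limg (p a)) == 0%N).
  have: p a v \in limg (p a) by rewrite memv_img ?memvf.
  move/eqP: dim0; rewrite dimv_eq0 => /eqP->; rewrite memv0 => /eqP->.
  exact: gen_eigenvector0.
by rewrite -a0; apply: eig_p.
Qed.

End Cartan.

(** * Engel's theorem *)

Section Engel.
Variables (F : fieldType) (V : vectType F) (br : {bilinear V -> V -> V}).
Hypothesis lie_br : is_lie_bracket br.

(** Say that a subalgebra K has the flag property if, for K-stable U and W with
U not contained in W, some u in U outside W satisfies [K, u] <= W. If K is a
proper subalgebra with this property, applying it to U = V and W = K gives x
outside K with [K, x] <= K; so K + <x> is a subalgebra. It has the flag property
too: starting from a vector u0 for K, the iterates of ad x on u0 are still sent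
into W by K, and the last one before W is entered is sent into W by x as well.
Thus V itself has the property, and W = 0 gives a central vector. *)
Lemma ad_nilpotent_center_neq0 : {:V}%VS != 0%VS ->
  (forall x v, exists k, iter k (br x) v = 0) ->
  exists2 z, z != 0 & forall x, br x z = 0.
Proof.
move=> V_neq0 nil_br.
pose stable (K U : {vspace V}) :=
  forall x u, x \in K -> u \in U -> br x u \in U.
pose flag (K : {vspace V}) := forall U W : {vspace V}, ~~ (U <= W)%VS ->
  stable K U -> stable K W ->
  exists u, [/\ u \in U, u \notin W & forall x, x \in K -> br x u \in W].
(* The disjunction lets K grow one dimension at a time until it is V. *)
suff [K [_ flagK K_full]] : exists K, [/\ stable K K, flag K &
    K = fullv \/ (\dim {:V} < \dim K)%N].
  case: K_full flagK => [->|]; last by rewrite ltnNge dimvS ?subvf.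
  case/(_ fullv 0%VS) => [||x u _|z [_ z_neq0 brz]].
  - by rewrite subv0.
  - by move=> x u _ _; rewrite memvf.
  - by rewrite !memv0 => /eqP->; rewrite linear0r.
  exists z => [|x]; first by rewrite -memv0.
  by apply/eqP; rewrite -memv0 brz ?memvf.
elim: (\dim {:V}).+1 => [|d [K [stK flagK K_full]]].
  exists 0%VS; split; [|move=> U W UW _ _|by right].
    by move=> x u; rewrite !memv0 => /eqP-> _; rewrite linear0l.
  have [u Uu Wu] := subvPn UW; exists u; split=> // x.
  by rewrite memv0 => /eqP->; rewrite linear0l mem0v.
have [K_fullv|K_proper] := eqVneq K fullv.
  by exists K; split=> //; left.
have {}K_full: (d <= \dim K)%N.
  by case: K_full K_proper => [->|//]; rewrite eqxx.
have [||//|x [_ K'x brKx]] := flagK fullv K.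
- by apply: contra K_proper; rewrite -[K == _]andbT eqEsubv subvf => ->.
- by move=> x u _ _; rewrite memvf.
have stabD (U : {vspace V}) :
    stable K U -> (forall u, u \in U -> br x u \in U) ->
    stable (K + <[x]>)%VS U.
  move=> stU stxU _ u /memv_addP[y Ky [_ /vlineP[c ->] ->]] Uu.
  by rewrite linearDl linearZl_LR /= memvD ?memvZ ?stxU ?stU.
have x_in: x \in (K + <[x]>)%VS by rewrite (subvP (addvSr _ _)) ?memv_line.
exists (K + <[x]>)%VS; split; last 1 first.
- right; apply: leq_ltn_trans K_full _.
  rewrite ltnNge; apply: contra K'x => le_dim.
  by rewrite (_ : K = K + <[x]>)%VS //; apply/eqP; rewrite eqEdim addvSl.
- have sub_K u : u \in K -> u \in (K + <[x]>)%VS by apply/subvP/addvSl.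
  apply: stabD => [y u Ky|u] /memv_addP[k Kk [_ /vlineP[c ->] ->]];
    apply: sub_K.
    by rewrite linearDr linearZr_LR /= memvD ?memvZ ?brKx ?stK.
  rewrite linearDr linearZr_LR /= brC // (proj1 lie_br) scaler0 addr0.
  by rewrite memvN brKx.
move=> U W UW stU stW.
have [||u0 [Uu0 W'u0 brKu0]] := flagK U W UW.
- by move=> y u Ky; apply: stU; rewrite (subvP (addvSl _ _)).
- by move=> y u Ky; apply: stW; rewrite (subvP (addvSl _ _)).
have stxU u : u \in U -> br x u \in U by apply: stU.
have stxW u : u \in W -> br x u \in W by apply: stW.
have iter_x k : iter k (br x) u0 \in U /\
    forall y, y \in K -> br y (iter k (br x) u0) \in W.
  elim: k => [|k [IHU IHW]] //=; split=> [|y Ky]; first exact: stxU.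
  by rewrite br_derivation // memvD ?stxW ?IHW ?brKx.
have [k nil_k] := nil_br x u0.
have ex_k: exists k, iter k (br x) u0 \in W by exists k; rewrite nil_k mem0v.
have [] := ex_minnP ex_k => -[|l] W_l min_l; first by rewrite W_l in W'u0.
have [Ul brKl] := iter_x l.
exists (iter l (br x) u0); split=> //.
  by apply/negP => /min_l; rewrite ltnn.
move=> _ /memv_addP[y Ky [_ /vlineP[c ->] ->]].
by rewrite linearDl linearZl_LR /= memvD ?memvZ ?(W_l : br x _ \in W) ?brKl.
Qed.

End Engel.

(** * Half-derivations *)

Section HalfDerivations.
Variables (F : fieldType) (charF0 : [pchar F] =i pred0).
Variables (V : vectType F) (br : {bilinear V -> V -> V}).
Hypothesis lie_br : is_lie_bracket br.
Hypothesis perfect_br : perfect br.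
Variable d : 'End(V).
Hypothesis half_derivation :
  forall x y, 2%:R *: d (br x y) = br (d x) y + br x (d y).

Lemma ad_half_derivation x :
  ad br (d x) = 2%:R *: (d \o ad br x)%VF - (ad br x \o d)%VF.
Proof.
apply/lfunP => y; rewrite add_lfunE opp_lfunE scale_lfunE !comp_lfunE !adE.
by rewrite half_derivation addrK.
Qed.

(** Taking traces in ad (d x) = 2 d ad x - ad x d, where the left-hand side has
trace 0, leaves tr (d ad x) = 0. *)
Lemma lftrace_half_derivation_ad x : lftrace (d \o ad br x)%VF = 0.
Proof.
have := lftrace_ad0 lie_br perfect_br (d x).
rewrite ad_half_derivation linearB linearZ /=.
by rewrite [lftrace (ad br x \o d)%VF]lftraceC mulr_natl mulr2n addrK.
Qed.

(** Both sides are 2 tr (d ad x ad y) - tr (d ad y ad x) up to exchanging x and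
y, and tr (d ad [x, y]) = 0 says that the exchange is harmless. *)
Lemma killing_half_derivation x y : killing br (d x) y = killing br x (d y).
Proof.
have := lftrace_half_derivation_ad (br x y).
rewrite ad_br // comp_lfunDr comp_lfunNr linearB /= => /eqP.
rewrite subr_eq0 => /eqP tr_d.
rewrite [RHS]killingC /killing !ad_half_derivation !comp_lfunDl !comp_lfunNl.
rewrite -!comp_lfunZl !linearB !linearZ /= -!comp_lfunA tr_d.
congr (_ - _); rewrite lftraceC -comp_lfunA.
by rewrite [RHS]lftraceC -comp_lfunA tr_d.
Qed.

(** With T (x, y, z) = k ([x, y], z), put a = T (x, y, d z), b = T (d x, y, z)
and c = T (x, d y, z). Self-adjointness of d gives b + c = 2 a, and cyclicity of
T turns this into c + a = 2 b; so 3 (a - b) = 0, and k is nondegenerate. *)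
Lemma half_derivation_centroid :
  (forall x, (forall y, killing br x y = 0) -> x = 0) ->
  forall x y, d (br x y) = br (d x) y.
Proof.
move=> nondeg x y.
pose T x y z := killing br (br x y) z.
have Tcyc u v w : T u v w = T v w u by rewrite /T killing_invariant // killingC.
have T_half u v w : T (d u) v w + T u (d v) w = 2%:R * T u v (d w).
  rewrite /T -killing_half_derivation -linearDl -half_derivation.
  by rewrite linearZl_LR.
apply/eqP; rewrite -subr_eq0; apply/eqP/nondeg => z.
have three_neq0 : 3%:R != 0 :> F by rewrite (pcharf0P F).1.
rewrite linearBl /= killing_half_derivation.
have E1 := T_half x y z.
have := T_half y z x.
rewrite -(Tcyc x (d y) z) -(Tcyc x y (d z)) -(Tcyc (d x) y z) => E2.
apply: (mulfI three_neq0); rewrite mulr0 -/(T x y (d z)) -/(T (d x) y z).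
move: (T x y (d z) : F) (T (d x) y z : F) (T x (d y) z : F) E1 E2.
move=> a b c E1 E2.
have -> : 3%:R * (a - b) = (c + a - 2%:R * b) - (b + c - 2%:R * a) by ring.
by rewrite E1 E2 !subrr.
Qed.

End HalfDerivations.

(** * Simple transposed Poisson algebras *)

Theorem theorem5 (F : closedFieldType) (charF0 : [pchar F] =i pred0)
    (P : vectType F) (mul br : {bilinear P -> P -> P})
    (tpP : is_transposed_poisson mul br)
    (simpleP : is_simple mul br)
    (br_neq0 : exists x y : P, br x y <> 0) :
  forall x y : P, mul x y = 0.
Proof.
have [mulA mulC lie_br compat] := tpP.
have two_neq0 : 2%:R != 0 :> F by rewrite (pcharf0P F).1.
have ideal_trivial (I : {vspace P}) : (forall x y, x \in I -> mul x y \in I) ->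
    (forall x y, x \in I -> br x y \in I) -> I = 0%VS \/ I = fullv.
  move=> mulI brI; have [->|I_neq0] := eqVneq I 0%VS; first by left.
  have [->|I_proper] := eqVneq I fullv; first by right.
  by case: (simpleP I).
have P_neq0 : {:P}%VS != 0%VS.
  apply/eqP => P0; have [x [y []]] := br_neq0.
  by apply/eqP; rewrite -memv0 -P0 memvf.
pose L x : 'End(P) := linfun (mul x).
have LE x y : L x y = mul x y by rewrite lfunE.
have L_half x y z : 2%:R *: L x (br y z) = br (L x y) z + br y (L x z).
  by rewrite !LE compat.
have perfect_br : perfect br.
  pose e := vbasis {:P}.
  pose D := <<[seq br x y | x <- e, y <- e]>>%VS.
  have br_D x y : br x y \in D.
    rewrite (coord_vbasis (memvf x)) linear_sumlz; apply: memv_suml => i _.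
    rewrite (coord_vbasis (memvf y)) linear_sumr; apply: memv_suml => j _.
    rewrite linearZl_LR linearZr_LR /= !memvZ //; apply: memv_span.
    by apply: allpairs_f; rewrite mem_nth // size_tuple.
  have D_min (W : {vspace P}) : (forall x y, br x y \in W) -> (D <= W)%VS.
    by move=> brW; apply/span_subvP => _ /allpairsP[z [_ _ ->]].
  (* {u | y o u \in D} contains all brackets, since 2 (y o [u, v]) is a sum of
     two brackets; so it contains D. *)
  have [|||D_full] := ideal_trivial D.
  - move=> x y xD; rewrite mulC -LE.
    have: (D <= L y @^-1: D)%VS.
      apply: D_min => u v; rewrite -memv_preim.
      by rewrite -[L y _](scalerK two_neq0) L_half memvZ ?memvD.
    by move/subvP/(_ x xD); rewrite -memv_preim.
  - by move=> x y _.
  - move=> D0; have [x [y []]] := br_neq0.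
    by apply/eqP; rewrite -memv0 -D0.
  by move=> W /D_min; rewrite D_full => fW; apply/eqP; rewrite eqEsubv subvf.
have center0 z : (forall x, br z x = 0) -> z = 0.
  have [Z ZP] := bilinear_left_kernel br.
  case: (ideal_trivial Z) => [x y /ZP brx0|x y /ZP ->|Z0|Zfull].
  (* For x central, the compatibility axiom reads 0 = [y o x, u] + 0. *)
  - apply/ZP => u; have := compat y x u.
    by rewrite brx0 linear0r scaler0 brx0 addr0 mulC.
  - exact: mem0v.
  - by move=> /ZP; rewrite Z0 memv0 => /eqP.
  by have [x [y []]] := br_neq0; apply: (ZP x).1; rewrite Zfull memvf.
have killing_L x y z : killing br (L x y) z = killing br y (L x z).
  exact: killing_half_derivation (L_half x) y z.
have nondeg x : (forall y, killing br x y = 0) -> x = 0.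
  have [K KP] := bilinear_left_kernel (killing br : {bilinear P -> P -> F^o}).
  (* The radical of the Killing form is an ideal, by self-adjointness of the
     multiplications and invariance of the form. *)
  case: (ideal_trivial K) => [u v /KP Ku|u v /KP Ku|K0|Kfull].
  - by apply/KP => w; rewrite mulC -LE; apply: etrans (killing_L _ _ _) (Ku _).
  - apply/KP => w; exact: etrans (killing_invariant lie_br _ _ _) (Ku _).
  - by move=> /KP; rewrite K0 memv0 => /eqP.
  have killing0 u v : killing br u v = 0.
    by apply: (KP u).1; rewrite Kfull memvf.
  have nil_br := killing0_ad_nilpotent charF0 lie_br perfect_br killing0.
  have [z /eqP z_neq0 brz0] := ad_nilpotent_center_neq0 lie_br P_neq0 nil_br.
  by case: z_neq0; apply: center0 => u; rewrite brC // brz0 oppr0.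
have centroid x u v : L x (br u v) = br (L x u) v.
  exact: half_derivation_centroid (L_half x) nondeg u v.
have scalar_L x : exists a, forall y, mul x y = a *: y.
  have [a [v v_neq0 Lv]] := endomorphism_eigenvector (L x) P_neq0.
  exists a => y; pose E := lker (L x - a *: \1)%VF.
  have EP u : (u \in E) = (mul x u == a *: u).
    by rewrite memv_ker shift_lfunE LE subr_eq0.
  case: (ideal_trivial E) => [u w|u w|E0|Efull].
  - rewrite !EP => /eqP xu; rewrite mulA xu linearZl_LR //.
  - by rewrite !EP => /eqP xu; rewrite -LE centroid LE xu linearZl_LR.
  - by move: v_neq0; rewrite -memv0 -E0 EP -LE Lv eqxx.
  by apply/eqP; rewrite -EP Efull memvf.
move=> x y; have [b yb] := scalar_L y.
have [b0|b_neq0] := eqVneq b 0; first by rewrite mulC yb b0 scale0r.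
(* A nonzero b would make every w a multiple of y. *)
have [u [v []]] := br_neq0.
have prop w : exists c, w = c *: y.
  have [c wc] := scalar_L w; exists (b^-1 * c).
  by rewrite -scalerA -wc mulC yb scalerK.
have [[c ->] [c' ->]] := (prop u, prop v).
by rewrite linearZl_LR linearZr_LR /= (proj1 lie_br) !scaler0.
Qed.
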